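(* Let $(X,\rho,\mu)$ be a $K$-doubling metric measure space, $(M,d)$ a complete metric space and $\mathcal D$ an $X$-distribution for $M$. If $\mathcal D$ is differentiably complete, then for every nonempty $A\subseteq X$ every function $f\colon A\to M$ is a.e. $\mathcal D$-differentiable on $A_f$. Conversely, if every function $f\colon X\to M$ is a.e. $\mathcal D$-differentiable on $A_f$, then $\mathcal D$ is differentiably complete.
   Context: A $K$-doubling metric measure space ($K>0$) is a triple $(X,\rho,\mu)$ where $(X,\rho)$ is a complete separable metric space and $\mu$ is a Borel-regular outer measure on $X$ with $0<\mu(B_{2r}(x))\le K\mu(B_r(x))<+\infty$ for all $x\in X$, $r>0$. A set $E\ni x$ is a $\mu$-neighborhood of $x$ if there is a Borel set $B\subseteq E$ with $\lim_{r\to0^+}\mu(B_r(x)\setminus B)/\mu(B_r(x))=0$; $x$ is a $\mu$-accumulation point of $A$ if $A\cap U\setminus\{x\}\ne\emptyset$ for every $\mu$-neighborhood $U$ of $x$; $\mu\text{-}\lim$ and $\mu\text{-}\limsup$ are the limit and upper limit along $\mu$-neighborhoods (e.g. $\mu\text{-}\limsup_{y\in A,y\to x}g(y)=\inf_U\sup_{y\in U\cap A\setminus\{x\}}g(y)$ over $\mu$-neighborhoods $U$ of $x$). For $x\in X$, $P\in M$, $\mathcal C_{x,P}$ is the set of classes $[F]$ of Lipschitz maps $F\colon B\to M$ defined on a metric neighborhood $B$ of $x$ with $F(x)=P$, modulo $F\sim G\iff\lim_{y\to x}d(F(y),G(y))/\rho(y,x)=0$. An $X$-distribution for $M$ is any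 subset $\mathcal D\subseteq\bigsqcup_{(x,P)}\mathcal C_{x,P}$, with $\mathcal D_{x,P}=\mathcal D\cap\mathcal C_{x,P}$. For $f\colon A\to M$ and an accumulation point $x\in A$ of $A$, $f$ is $\mathcal D$-differentiable at $x$ if some $[F]\in\mathcal D_{x,f(x)}$ satisfies $\lim_{y\in A,y\to x}d(f(y),F(y))/\rho(y,x)=0$; for a $\mu$-accumulation point $x\in A$, $f$ is approximately $\mathcal D$-differentiable at $x$ if some $[F]\in\mathcal D_{x,f(x)}$ satisfies $\mu\text{-}\lim_{y\in A,y\to x}d(f(y),F(y))/\rho(y,x)=0$. $A_f$ is the set of accumulation points $x\in A$ of $A$ with $\limsup_{y\in A,y\to x}d(f(y),f(x))/\rho(y,x)<+\infty$, and $A_f^\mu$ the set of $\mu$-accumulation points $x\in A$ of $A$ with $\mu\text{-}\limsup_{y\in A,y\to x}d(f(y),f(x))/\rho(y,x)<+\infty$. ''$f$ is a.e. $\mathcal D$-differentiable on $A_f$'' means: for every $\mu$-measurable $B\subseteq A_f$, $f$ is $\mathcal D$-differentiable at $\mu$-a.e. point of $B$ (similarly for the approximate notion on $A_f^\mu$). $\mathcal D$ is differentiably complete if for every nonempty closed $C\subseteq X$ and every Lipschitz $g\colon C\to M$, $g$ is a.e. approximately $\mathcal D$-differentiable on $A_g^\mu$. *)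

(* Defs.v *)
From HB Require Import structures.
From mathcomp Require Import all_boot all_order all_algebra.
From mathcomp Require Import all_classical all_reals all_analysis.
Set Implicit Arguments. Unset Strict Implicit. Unset Printing Implicit Defensive.
Import Order.TTheory GRing.Theory Num.Theory.
Local Open Scope classical_set_scope.
Local Open Scope ring_scope.

Definition is_metric {R : realType} {T : Type} (m : T -> T -> R) : Prop :=
  (forall x y, m x y = 0 <-> x = y) /\ (forall x y, m x y = m y x) /\
  (forall x y z, m x z <= m x y + m y z).

Definition mball {R : realType} {T : Type} (m : T -> T -> R) (x : T) (r : R)
  : set T := [set y | m x y < r].

Definition m_cauchy {R : realType} {T : Type} (m : T -> T -> R) (u : nat -> T) :=
  forall eps : R, 0 < eps -> exists N : nat,
    forall p q : nat, (N <= p)%N -> (N <= q)%N -> m (u p) (u q) < eps.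

Definition m_converges {R : realType} {T : Type} (m : T -> T -> R) (u : nat -> T) (l : T) :=
  forall eps : R, 0 < eps -> exists N : nat, forall n : nat, (N <= n)%N -> m (u n) l < eps.

Definition complete_metric {R : realType} {T : Type} (m : T -> T -> R) : Prop :=
  is_metric m /\ forall u, m_cauchy m u -> exists l, m_converges m u l.

Definition separable_metric {R : realType} {T : Type} (m : T -> T -> R) : Prop :=
  exists S : set T, countable S /\
    forall x r, 0 < r -> exists y, S y /\ m x y < r.

Definition m_open {R : realType} {T : Type} (m : T -> T -> R) (U : set T) : Prop :=
  forall x, U x -> exists2 r : R, 0 < r & mball m x r `<=` U.

Definition m_closed {R : realType} {T : Type} (m : T -> T -> R) (C : set T) : Prop :=
  forall x, (forall r : R, 0 < r -> exists y, C y /\ m x y < r) -> C x.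

Definition m_borel {R : realType} {T : Type} (m : T -> T -> R) : set (set T) :=
  <<s m_open m >>.

Definition lipschitz_on {R : realType} {X M : Type} (rho : X -> X -> R)
  (d : M -> M -> R) (C : set X) (g : X -> M) : Prop :=
  exists L : R, forall y z, C y -> C z -> d (g y) (g z) <= L * rho y z.

Definition borel_regular {R : realType} {X : Type} (rho : X -> X -> R)
  (mu : {outer_measure set X -> \bar R}) : Prop :=
  (forall B, m_borel rho B -> mu.-caratheodory B) /\
  (forall A, exists B, [/\ m_borel rho B, A `<=` B & mu B = mu A]).

Definition doubling_mms {R : realType} {X : Type} (rho : X -> X -> R)
  (mu : {outer_measure set X -> \bar R}) (K : R) : Prop :=
  [/\ 0 < K, complete_metric rho, separable_metric rho, borel_regular rho mu &
    forall x r, 0 < r ->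
      [/\ (0 < mu (mball rho x (2 * r)))%E,
          (mu (mball rho x (2 * r)) <= K%:E * mu (mball rho x r))%E &
          (mu (mball rho x r) < +oo)%E]].

Definition mu_nbhd {R : realType} {X : Type} (rho : X -> X -> R)
  (mu : {outer_measure set X -> \bar R}) (x : X) (E : set X) : Prop :=
  E x /\ exists B, [/\ m_borel rho B, B `<=` E &
    forall eps : R, 0 < eps -> exists2 delta : R, 0 < delta &
      forall r : R, 0 < r -> r < delta ->
        `| fine (mu (mball rho x r `\` B)) / fine (mu (mball rho x r)) | < eps].

Definition acc_pt {R : realType} {X : Type} (rho : X -> X -> R) (A : set X) (x : X) :=
  forall r : R, 0 < r -> exists y, [/\ A y, rho x y < r & y <> x].

Definition mu_acc_pt {R : realType} {X : Type} (rho : X -> X -> R)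
  (mu : {outer_measure set X -> \bar R}) (A : set X) (x : X) :=
  forall U, mu_nbhd rho mu x U -> exists y, [/\ A y, U y & y <> x].

Definition lim0_at {R : realType} {X : Type} (rho : X -> X -> R) (A : set X) (x : X)
  (g : X -> R) :=
  forall eps : R, 0 < eps -> exists2 delta : R, 0 < delta &
    forall y, A y -> y <> x -> rho y x < delta -> `| g y | < eps.

Definition mu_lim0_at {R : realType} {X : Type} (rho : X -> X -> R)
  (mu : {outer_measure set X -> \bar R}) (A : set X) (x : X) (g : X -> R) :=
  forall eps : R, 0 < eps -> exists U, mu_nbhd rho mu x U /\
    forall y, U y -> A y -> y <> x -> `| g y | < eps.

Definition limsup_at {R : realType} {X : Type} (rho : X -> X -> R) (A : set X) (x : X)
  (g : X -> R) : \bar R :=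
  ereal_inf [set ereal_sup [set (g y)%:E | y in (mball rho x r `&` A) `\ x]
            | r in [set r : R | 0 < r]].

Definition mu_limsup_at {R : realType} {X : Type} (rho : X -> X -> R)
  (mu : {outer_measure set X -> \bar R}) (A : set X) (x : X) (g : X -> R) : \bar R :=
  ereal_inf [set ereal_sup [set (g y)%:E | y in (U `&` A) `\ x]
            | U in mu_nbhd rho mu x].

(* F : X -> M represents a Lipschitz map defined on a metric neighborhood of x
   (a ball around x) with F x = P; values off that ball are irrelevant. *)
Definition lip_germ {R : realType} {X M : Type} (rho : X -> X -> R)
  (d : M -> M -> R) (x : X) (P : M) (F : X -> M) : Prop :=
  F x = P /\ exists2 r : R, 0 < r & lipschitz_on rho d (mball rho x r) F.

Definition germ_eq {R : realType} {X M : Type} (rho : X -> X -> R)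
  (d : M -> M -> R) (x : X) (F G : X -> M) : Prop :=
  lim0_at rho setT x (fun y => d (F y) (G y) / rho y x).

(* An X-distribution (a set of classes [F] in the disjoint union of the C_{x,P})
   is represented by the set D x P of all representatives of its classes in
   C_{x,P}: D consists of Lipschitz germs and is saturated under ~. *)
Definition is_distribution {R : realType} {X M : Type} (rho : X -> X -> R)
  (d : M -> M -> R) (D : X -> M -> (X -> M) -> Prop) : Prop :=
  (forall x P F, D x P F -> lip_germ rho d x P F) /\
  (forall x P F G, D x P F -> lip_germ rho d x P G -> germ_eq rho d x F G ->
     D x P G).

(* f : A -> M is represented by f : X -> M (only values on A matter) *)
Definition D_diff_at {R : realType} {X M : Type} (rho : X -> X -> R)
  (d : M -> M -> R) (D : X -> M -> (X -> M) -> Prop) (A : set X) (f : X -> M)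
  (x : X) : Prop :=
  [/\ A x, acc_pt rho A x &
    exists F, D x (f x) F /\ lim0_at rho A x (fun y => d (f y) (F y) / rho y x)].

Definition approx_D_diff_at {R : realType} {X M : Type} (rho : X -> X -> R)
  (d : M -> M -> R) (mu : {outer_measure set X -> \bar R})
  (D : X -> M -> (X -> M) -> Prop) (A : set X) (f : X -> M) (x : X) : Prop :=
  [/\ A x, mu_acc_pt rho mu A x &
    exists F, D x (f x) F /\ mu_lim0_at rho mu A x (fun y => d (f y) (F y) / rho y x)].

Definition A_f {R : realType} {X M : Type} (rho : X -> X -> R) (d : M -> M -> R)
  (A : set X) (f : X -> M) : set X :=
  [set x | [/\ A x, acc_pt rho A x &
     (limsup_at rho A x (fun y => (d (f y) (f x) / rho y x)%R) < +oo)%E]].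

Definition A_f_mu {R : realType} {X M : Type} (rho : X -> X -> R) (d : M -> M -> R)
  (mu : {outer_measure set X -> \bar R}) (A : set X) (f : X -> M) : set X :=
  [set x | [/\ A x, mu_acc_pt rho mu A x &
     (mu_limsup_at rho mu A x (fun y => (d (f y) (f x) / rho y x)%R) < +oo)%E]].

Definition ae_D_diff {R : realType} {X M : Type} (rho : X -> X -> R)
  (d : M -> M -> R) (mu : {outer_measure set X -> \bar R})
  (D : X -> M -> (X -> M) -> Prop) (A : set X) (f : X -> M) : Prop :=
  forall B, mu.-caratheodory B -> B `<=` A_f rho d A f ->
    mu [set x | B x /\ ~ D_diff_at rho d D A f x] = 0%E.

Definition ae_approx_D_diff {R : realType} {X M : Type} (rho : X -> X -> R)
  (d : M -> M -> R) (mu : {outer_measure set X -> \bar R})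
  (D : X -> M -> (X -> M) -> Prop) (A : set X) (f : X -> M) : Prop :=
  forall B, mu.-caratheodory B -> B `<=` A_f_mu rho d mu A f ->
    mu [set x | B x /\ ~ approx_D_diff_at rho d mu D A f x] = 0%E.

Definition diff_complete {R : realType} {X M : Type} (rho : X -> X -> R)
  (d : M -> M -> R) (mu : {outer_measure set X -> \bar R})
  (D : X -> M -> (X -> M) -> Prop) : Prop :=
  forall (C : set X) (g : X -> M), C !=set0 -> m_closed rho C ->
    lipschitz_on rho d C g -> ae_approx_D_diff rho d mu D C g.

(* Main.v *)
(* If [D] is differentiably complete, cut [A_f] (Stepanov) into countably many
   pieces [E] of small diameter with [d (f z) (f y) <= k * rho z y] for [y] in [E]
   and every nearby [z] in [A]. As [M] is complete, [f] extends from [E] to a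
   Lipschitz [g] on the closure [C] of [E], and [g] is approximately
   differentiable almost everywhere on [C], with derivative [F] say. At a density
   point [x] of [C] the set where [g] is close to [F] has density one, so by
   doubling it comes within [o(rho x z)] of each [z] near [x]; the one-sided
   estimate then carries the closeness from that set to all [z] in [A].
   Conversely, a Lipschitz [g] on a closed [C] is composed with an almost nearest
   point map onto [C]. The resulting map on [X] need not be continuous, but its
   upper Lipschitz constant is finite at each point of [C]. *)

Require Import Defs.
From HB Require Import structures.
From mathcomp Require Import all_boot all_order all_algebra.
From mathcomp Require Import all_classical all_reals all_analysis.
From mathcomp Require Import lra.
Set Implicit Arguments. Unset Strict Implicit. Unset Printing Implicit Defensive.
Import Order.TTheory GRing.Theory Num.Theory.
Local Open Scope classical_set_scope.
Local Open Scope ring_scope.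

(** * Metric balls and Vitali covering *)

Lemma metric_xx (R : realType) (T : Type) (m : T -> T -> R) x :
  is_metric m -> m x x = 0.
Proof. by move=> [/(_ x x) [_ ->]]. Qed.

Lemma metric_ge0 (R : realType) (T : Type) (m : T -> T -> R) x y :
  is_metric m -> 0 <= m x y.
Proof.
move=> mm; have [_ [sym tri]] := mm; have := tri x y x.
by rewrite metric_xx // (sym y x); lra.
Qed.

Lemma metric_gt0 (R : realType) (T : Type) (m : T -> T -> R) x y :
  is_metric m -> x <> y -> 0 < m x y.
Proof.
move=> mm xy; rewrite lt_neqAle metric_ge0 // andbT eq_sym.
by apply/eqP => /(mm.1 x y).1.
Qed.

Lemma mball_open (R : realType) (T : Type) (m : T -> T -> R) x r :
  is_metric m -> m_open m (mball m x r).
Proof.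
move=> [_ [_ tri]] y xy; exists (r - m x y); first by rewrite subr_gt0.
by move=> z yz; rewrite /mball /= in xy yz *; have := tri x y z; lra.
Qed.

Lemma mball_setU (R : realType) (T : Type) (m : T -> T -> R) x y r s :
  is_metric m -> m x y + r <= s -> mball m y r `<=` mball m x s.
Proof. by move=> [_ [_ tri]] h z; rewrite /mball /= => yz; have := tri x y z; lra. Qed.

Lemma vitali_centers (R : realType) (T : Type) (m : T -> T -> R) (N : set T)
    (rad : T -> R) (R0 : R) : is_metric m ->
  (forall x, N x -> 0 < rad x <= R0) ->
  exists G : set T, [/\ G `<=` N,
    (forall x y z, G x -> G y -> mball m x (rad x) z -> mball m y (rad y) z -> x = y) &
    forall x, N x -> exists y, G y /\ m y x < 4 * rad y].
Proof.
move=> mm radN; have [_ [sym tri]] := mm.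
pose meet x y := exists z, mball m x (rad x) z /\ mball m y (rad y) z.
(* A maximal disjoint family alone does not suffice: every ball met by the family
   must also meet a member of at least half its radius. *)
pose P (G : set T) := [/\ G `<=` N,
   (forall x y, G x -> G y -> meet x y -> x = y) &
   forall x, N x -> (exists2 y, G y & meet x y) ->
     exists y, [/\ G y, meet x y & rad x <= 2 * rad y]].
have [F FP Ftot|G [[GN Gdis Gbig] Gmax]] := @Zorn_bigcup _ P.
  split.
  - by move=> x [G /FP[GN _ _] Gx]; exact: GN.
  - move=> x y [G FG Gx] [H FH Hy].
    have [GH|HG] := Ftot _ _ FG FH.
    + by have [_ + _] := FP _ FH; apply => //; exact: GH.
    + by have [_ + _] := FP _ FG; apply => //; exact: HG.
  - move=> x Nx [y [G FG Gy] xy].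
    have [_ _ /(_ x Nx)[|z [Gz ? ?]]] := FP _ FG; first by exists y.
    by exists z; split => //; exists G.
(* If some balls missed the family, one whose radius exceeds half the supremum of the radii of such
   balls could be added to [G], against maximality. *)
have Gall x : N x -> exists2 y, G y & meet x y.
  move=> Nx; apply: contrapT => Gx.
  pose N' := [set rad x | x in [set x | N x /\ ~ exists2 y, G y & meet x y]].
  have N'sup : has_sup N'.
    by split; [exists (rad x), x | exists R0 => _ [y [Ny _] <-]; case/andP: (radN y Ny)].
  have s0 : 0 < sup N'.
    case/andP: (radN x Nx) => r0 _; apply: lt_le_trans r0 _.
    by apply: ub_le_sup; [case: N'sup | exists x].
  have [|_ [x0 [Nx0 Gx0] <-] x0s] := @sup_adherent _ N' (sup N' / 2) _ N'sup.
    by rewrite divr_gt0.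
  have self y : N y -> meet y y.
    move=> Ny; case/andP: (radN y Ny) => r0 _.
    by exists y; rewrite /mball /= metric_xx.
  apply: (Gmax (G `|` [set x0])).
    split; first by left.
    move=> /(_ x0); rewrite /= => H; apply: Gx0; exists x0; last exact: self.
    by apply: H; right.
  split.
  - by move=> y [/GN//|->].
  - move=> y z [Gy|->] [Gz|->] yz //.
    + exact: Gdis.
    + by case: Gx0; exists y => //; case: yz => w [? ?]; exists w.
    + by case: Gx0; exists z.
  - move=> y Ny yG; have [Gy|Gy] := pselect (exists2 z, G z & meet y z).
      by have [z [Gz ? ?]] := Gbig y Ny Gy; exists z; split => //; left.
    exists x0; split; first by right.
      by case: yG => z [Gz|->] // yz; case: Gy; exists z.
    have : rad y <= sup N' by apply: ub_le_sup; [case: N'sup | exists y].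
    by move: x0s; set S := sup N'; lra.
exists G; split => //.
- by move=> x y z Gx Gy xz yz; apply: Gdis => //; exists z.
(* The triangle inequality gives the factor 3; it is relaxed to 4, a power of two, so that doubling
   is applied exactly twice later. *)
- move=> x Nx; have [y [Gy [z [xz yz]] xy]] := Gbig x Nx (Gall x Nx).
  exists y; split => //; have := tri y z x; rewrite (sym z x).
  by have /andP[] := radN y (GN y Gy); move: xz yz; rewrite /mball /=; lra.
Qed.

Lemma separable_dense_seq (R : realType) (T : Type) (m : T -> T -> R) (x0 : T) :
  separable_metric m -> exists s : nat -> T, forall x r, 0 < r -> exists n, m x (s n) < r.
Proof.
move=> [S [/countable_injP[f finj] Sd]].
(* Indices that [f] does not attain on [S] get the default value [x0]. *)
have /choice[s sP] n : exists y, forall z, S z -> f z = n -> y = z.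
  have [[z [Sz fz]]|nz] := pselect (exists z, S z /\ f z = n).
    by exists z => w Sw fw; apply: finj; rewrite ?inE // fw.
  by exists x0 => z Sz fz; case: nz; exists z.
exists s => x r r0; have [y [Sy xy]] := Sd x r r0.
by exists (f y); rewrite (sP (f y) y).
Qed.

(** * Null sets and continuity from above for outer measures *)

Lemma outer_measure_bigcup0 (R : realType) (T : Type)
    (mu : {outer_measure set T -> \bar R}) (F : nat -> set T) :
  (forall n, mu (F n) = 0%E) -> mu (\bigcup_n F n) = 0%E.
Proof.
move=> F0; apply/eqP; rewrite eq_le outer_measure_ge0 andbT.
apply: (le_trans (outer_measure_sigma_subadditive mu F)).
by rewrite eseries0.
Qed.

Lemma subset_outer_measure0 (R : realType) (T : Type)
    (mu : {outer_measure set T -> \bar R}) (A B : set T) :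
  A `<=` B -> mu B = 0%E -> mu A = 0%E.
Proof.
move=> AB B0; apply/eqP; rewrite eq_le outer_measure_ge0 andbT -B0.
exact: le_outer_measure.
Qed.

Lemma caratheodory_null (R : realType) (T : Type)
    (mu : {outer_measure set T -> \bar R}) (A : set T) :
  mu A = 0%E -> mu.-caratheodory A.
Proof.
move=> A0; apply: le_caratheodory_measurable => Y.
rewrite (@subset_outer_measure0 _ _ _ (Y `&` A) A) // add0e.
by apply: le_outer_measure; exact: subIsetl.
Qed.

Lemma caratheodory_cvg0 (R : realType) (T : Type)
    (mu : {outer_measure set T -> \bar R}) (F : nat -> set T) :
  (forall n, mu.-caratheodory (F n)) -> nonincreasing_seq F ->
  (mu (F 0%N) < +oo)%E -> \bigcap_n F n = set0 ->
  mu \o F @ \oo --> 0%E.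
Proof.
(* The empty type is split off; on an inhabited one, continuity from above holds for the measure
   induced by [mu] on its Caratheodory sets. *)
elim/Ppointed : T mu F => T mu F mF dF F0 capF.
  rewrite (_ : mu \o F = cst 0%E); first exact: cvg_cst.
  by apply/funext => n /=; rewrite [F n]emptyE outer_measure0.
rewrite -(outer_measure0 mu) -capF.
apply: (@nonincreasing_cvg_mu _ (caratheodory_type mu) _ mu) => //.
by rewrite capF; exact: measurable0.
Qed.

(** * Doubling measures *)

Lemma doubling_mball_pow (R : realType) (X : Type) (rho : X -> X -> R)
    (mu : {outer_measure set X -> \bar R}) (K : R) m x r :
  doubling_mms rho mu K -> 0 < r ->
  (mu (mball rho x (2 ^+ m * r)) <= (K ^+ m)%:E * mu (mball rho x r))%E.
Proof.
move=> [K0 _ _ _ dbl] r0; elim: m => [|m IHm]; first by rewrite !expr0 mul1r mul1e.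
rewrite !exprS -mulrA EFinM -muleA.
have [|_ + _] := dbl x (2 ^+ m * r); first by rewrite mulr_gt0 // exprn_gt0.
by move=> /le_trans; apply; rewrite lee_pmul2l.
Qed.

Lemma doubling_mball_gt0 (R : realType) (X : Type) (rho : X -> X -> R)
    (mu : {outer_measure set X -> \bar R}) (K : R) x r :
  doubling_mms rho mu K -> 0 < r -> (0 < mu (mball rho x r) < +oo)%E.
Proof.
move=> [_ _ _ _ dbl] r0; have [_ _ ->] := dbl x r r0; rewrite andbT.
have [|+ _ _] := dbl x (r / 2); first by rewrite divr_gt0.
by rewrite mulrC divfK.
Qed.

Lemma doubling_caratheodory_open (R : realType) (X : Type) (rho : X -> X -> R)
    (mu : {outer_measure set X -> \bar R}) (K : R) U :
  doubling_mms rho mu K -> m_open rho U -> mu.-caratheodory U.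
Proof.
by move=> [_ _ _ [bor _] _] oU; apply: bor; exact: sub_sigma_algebra.
Qed.

(** Fourfold enlargements of disjoint Vitali balls cover [N]. Doubling twice costs [K ^+ 2], the
    hypothesis trades each ball for its part in [W], and these parts are disjoint. *)
Lemma doubling_vitali (R : realType) (X : Type) (rho : X -> X -> R)
    (mu : {outer_measure set X -> \bar R}) (K t : R) (N W : set X) :
  doubling_mms rho mu K -> 0 < t ->
  (forall x, N x -> exists r, 0 < r <= 1 /\
    (t%:E * mu (mball rho x r) <= mu (W `&` mball rho x r))%E) ->
  (t%:E * mu N <= (K ^+ 2)%:E * mu W)%E.
Proof.
move=> dbl t0 NW; have [K0 [mm _] sep _ _] := dbl.
have [[x0 Nx0]|N0] := pselect (exists x, N x); last first.
  have -> : N = set0 by rewrite -subset0 => x Nx; case: N0; exists x.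
  by rewrite outer_measure0 mule0 mule_ge0 ?outer_measure_ge0 // lee_fin sqr_ge0.
have /choice[rad radP] x : exists r, N x -> 0 < r <= 1 /\
    (t%:E * mu (mball rho x r) <= mu (W `&` mball rho x r))%E.
  by have [/NW[r ?]|] := pselect (N x); [exists r | exists 0].
have [|G [GN Gdis Gcov]] := @vitali_centers _ _ rho N rad 1 mm.
  by move=> x /radP[].
have [s sdense] := separable_dense_seq x0 sep.
(* The disjoint balls are indexed by the dense points they contain, hence countable. *)
have /choice[phi phiP] y : exists n, G y -> mball rho y (rad y) (s n).
  have [Gy|] := pselect (G y); last by exists 0%N.
  have [/andP[r0 _] _] := radP _ (GN _ Gy).
  by have [n ?] := sdense y _ r0; exists n.
have phi_inj y z : G y -> G z -> phi y = phi z -> y = z.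
  by move=> Gy Gz yz; apply: (Gdis _ _ (s (phi y))) => //; [|rewrite yz]; exact: phiP.
(* As [phi] is injective on [G], each index carries at most one ball: [U n] and [V n] are a ball and
   its fourfold enlargement, or both are empty. *)
pose U n := [set z | exists y, [/\ G y, phi y = n & mball rho y (rad y) z]].
pose V n := [set z | exists y, [/\ G y, phi y = n & mball rho y (2 ^+ 2 * rad y) z]].
have UV n : (exists y, [/\ G y, U n = mball rho y (rad y) &
      V n = mball rho y (2 ^+ 2 * rad y)]) \/ (U n = set0 /\ V n = set0).
  have [[y [Gy yn]]|nG] := pselect (exists y, G y /\ phi y = n).
    left; exists y; split => //; apply/seteqP; split => [z [w [Gw wn]]|z yz].
    - by rewrite (phi_inj y w) // yn.
    - by exists y.
    - by rewrite (phi_inj y w) // yn.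
    - by exists y.
  by right; split; rewrite -subset0 => z [y [Gy yn _]]; apply: nG; exists y.
have mU n : mu.-caratheodory (U n).
  have [[y [_ -> _]]|[-> _]] := UV n; last exact: caratheodory_measurable_set0.
  by apply: (doubling_caratheodory_open dbl); exact: mball_open.
have tU : trivIset setT U.
  move=> m n _ _ [z [[y [Gy <- yz]] [w [Gw <- wz]]]].
  by rewrite (Gdis y w z).
have VU n : (t%:E * mu (V n) <= (K ^+ 2)%:E * mu (W `&` U n))%E.
  have [[y [Gy -> ->]]|[-> ->]] := UV n; last first.
    by rewrite setI0 outer_measure0 !mule0.
  have [/andP[r0 _] yW] := radP _ (GN _ Gy).
  apply: (@le_trans _ _ (t%:E * ((K ^+ 2)%:E * mu (mball rho y (rad y))))%E).
    by rewrite lee_pmul2l //; exact: doubling_mball_pow dbl r0.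
  by rewrite muleCA lee_pmul2l // lte_fin exprn_gt0.
have NV : N `<=` \bigcup_n V n.
  move=> x Nx; have [y [Gy yx]] := Gcov x Nx; exists (phi y) => //.
  by exists y; split => //; rewrite /mball /=; lra.
apply: (@le_trans _ _ (t%:E * \sum_(n <oo) mu (V n))%E).
  rewrite lee_pmul2l //; apply: (le_trans (le_outer_measure mu _ _ NV)).
  exact: outer_measure_sigma_subadditive.
rewrite -nneseriesZl; last by move=> *; exact: outer_measure_ge0.
apply: (@le_trans _ _ (\sum_(n <oo) ((K ^+ 2)%:E * mu (W `&` U n)))%E).
  apply: lee_nneseries => [n _ _|n _]; last exact: VU.
  by rewrite mule_ge0 ?outer_measure_ge0 // lee_fin ltW.
rewrite nneseriesZl; last by move=> *; exact: outer_measure_ge0.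
rewrite lee_pmul2l // ?lte_fin ?exprn_gt0 //.
(* Only the [U n] cut, so additivity over them holds for an arbitrary [W]. *)
apply: le_trans (caratheodory_lime_le mU tU W).
by rewrite leeDl // outer_measure_ge0.
Qed.

(** * Lebesgue density for closed sets *)

Lemma m_closedC (R : realType) (T : Type) (m : T -> T -> R) (C : set T) :
  m_closed m C -> m_open m (~` C).
Proof.
move=> clC x Cx; apply: contrapT => nx; apply: Cx; apply: clC => r r0.
apply: contrapT => nr; apply: nx; exists r => // y xy Cy; apply: nr.
by exists y.
Qed.

Lemma m_openI (R : realType) (T : Type) (m : T -> T -> R) (U V : set T) :
  m_open m U -> m_open m V -> m_open m (U `&` V).
Proof.
move=> oU oV x [/oU[r r0 xr] /oV[s s0 xs]].
exists (Num.min r s); first by rewrite lt_min r0.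
move=> y; rewrite /mball /= lt_min => /andP[? ?].
by split; [exact: xr | exact: xs].
Qed.

(** The multiplied form avoids quotients of extended reals, and the outer measure lets [C] be any
    set, in particular a [mu]-neighborhood. *)
Definition density_pt (R : realType) (X : Type) (rho : X -> X -> R)
    (mu : {outer_measure set X -> \bar R}) (C : set X) (x : X) : Prop :=
  forall eps : R, 0 < eps -> exists2 delta : R, 0 < delta &
    forall r, 0 < r -> r < delta ->
      (mu (mball rho x r `\` C) <= eps%:E * mu (mball rho x r))%E.

(** Arbitrarily small balls at a point of [N n k] have a fixed proportion outside [C]. That part
    lies in a thin collar of [C], so the covering estimate bounds [mu (N n k)] by a multiple of the
    measure of the collar, which tends to 0. *)
Lemma doubling_lebesgue_density (R : realType) (X : Type) (rho : X -> X -> R)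
    (mu : {outer_measure set X -> \bar R}) (K : R) (C : set X) :
  doubling_mms rho mu K -> m_closed rho C ->
  mu (C `\` density_pt rho mu C) = 0%E.
Proof.
move=> dbl clC; have [K0 [mm _] _ _ _] := dbl.
have [[x0 Cx0]|C0] := pselect (exists x, C x); last first.
  rewrite (_ : _ `\` _ = set0) ?outer_measure0 // -subset0 => x [Cx _].
  by apply: C0; exists x.
pose N n k := [set x | [/\ C x, rho x0 x < k%:R & forall delta, 0 < delta ->
  exists2 r, 0 < r < delta &
    ((n.+1%:R^-1)%:E * mu (mball rho x r) <= mu (mball rho x r `\` C))%E]].
apply: (@subset_outer_measure0 _ _ _ _ (\bigcup_n \bigcup_k N n k)).
  move=> x [Cx /existsNP[e /not_implyP[e0 xd]]].
  have [n _ ne] := near_infty_natSinv_lt (PosNum e0).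
  have [k xk] : exists k : nat, rho x0 x < k%:R.
    by exists (Num.truncn (rho x0 x)).+1; exact: truncnS_gt.
  exists n => //; exists k => //; split => // delta d0.
  apply: contrapT => nr; apply: xd; exists delta => // r r0 rd.
  rewrite leNgt; apply/negP => h; apply: nr; exists r; first by rewrite r0.
  apply/ltW/(le_lt_trans _ h); have /andP[mr0 mroo] := doubling_mball_gt0 x dbl r0.
  by rewrite lee_pmul2r ?ge0_fin_numE ?outer_measure_ge0 // lee_fin ltW // (ne n (leqnn n)).
apply: outer_measure_bigcup0 => n; apply: outer_measure_bigcup0 => k.
(* The bound [k%:R + 1] makes the collar of finite measure and still contains the balls in use,
   whose centers are within [k%:R] of [x0] and whose radii are at most 1. *)
pose W j := ~` C `&` mball rho x0 (k%:R + 1) `&`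
  [set y | exists2 c, C c & mball rho c j.+1%:R^-1 y].
have mW j : mu.-caratheodory (W j).
  apply: (doubling_caratheodory_open dbl); apply: m_openI; first apply: m_openI.
  - exact: m_closedC.
  - exact: mball_open.
  - move=> y [c Cc cy]; have [r r0 yr] := mball_open mm cy.
    by exists r => // z /yr; exists c.
have natS j : 0 < j.+1%:R^-1 :> R by rewrite invr_gt0.
have Wcvg : mu \o W @ \oo --> 0%E.
  apply: caratheodory_cvg0 => //.
  - move=> i j ij; apply/subsetPset => y [[Cy x0y] [c Cc cy]]; split => //.
    by exists c => //; apply: lt_le_trans cy _; rewrite lef_pV2 ?posrE ?ler_nat.
  - have /(doubling_mball_gt0 x0 dbl)/andP[_] : (0 : R) < k%:R + 1 by rewrite ltr_wpDl.
    by apply: le_lt_trans; apply: le_outer_measure => y [[_ ?] _].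
  (* A point in all the collars is a limit of points of [C], hence in [C] because [C] is closed. *)
  - rewrite -subset0 => y Wy; have [[Cy _] _] := Wy 0%N I.
    apply: Cy; apply: clC => r r0.
    have [j _ jr] := near_infty_natSinv_lt (PosNum r0).
    have [_ [c Cc cy]] := Wy j I; exists c; split => //.
    by rewrite mm.2.1; apply: lt_trans cy (jr j (leqnn j)).
have NW j : ((n.+1%:R^-1)%:E * mu (N n k) <= (K ^+ 2)%:E * mu (W j))%E.
  apply: (doubling_vitali dbl) => // x [Cx x0x xr].
  have [r /andP[r0 rj] h] := xr _ (natS j).
  have j1 : j.+1%:R^-1 <= 1 :> R by rewrite invf_le1 ?ler1n.
  exists r; split; first by rewrite r0 (ltW (lt_le_trans rj j1)).
  apply: (le_trans h); apply: le_outer_measure => y [xy Cy]; split => //.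
  split; last by exists x => //; apply: lt_trans xy rj.
  split => //; apply: (mball_setU mm _ xy); rewrite lerD ?ltW //.
  exact: lt_le_trans rj j1.
apply/eqP; rewrite eq_le outer_measure_ge0 andbT.
rewrite -(@lee_pmul2l _ (n.+1%:R^-1)%:E) // mule0 -(mule0 (K ^+ 2)%:E).
apply: (cvge_ge _ (cvgeZl _ Wcvg)) => //.
by apply: nearW => j; exact: NW.
Qed.

(** * Neighborhoods in measure and density points *)

Lemma mball_nbhd (R : realType) (X : Type) (rho : X -> X -> R)
    (mu : {outer_measure set X -> \bar R}) x r :
  is_metric rho -> 0 < r -> mu_nbhd rho mu x (mball rho x r).
Proof.
move=> mm r0; split; first by rewrite /mball /= metric_xx.
exists (mball rho x r); split => //.
  by apply: sub_sigma_algebra; exact: mball_open.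
move=> e e0; exists r => // s s0 sr.
rewrite (_ : _ `\` _ = set0); last first.
  by rewrite -subset0 => y [/= xy]; apply; exact: lt_trans xy sr.
by rewrite outer_measure0 /= mul0r normr0.
Qed.

Lemma mu_nbhd_density (R : realType) (X : Type) (rho : X -> X -> R)
    (mu : {outer_measure set X -> \bar R}) (K : R) x U :
  doubling_mms rho mu K -> mu_nbhd rho mu x U -> density_pt rho mu U x.
Proof.
move=> dbl [_ [B [_ BU Bd]]] e e0; have [delta d0 h] := Bd e e0.
exists delta => // r r0 rd.
(* Balls have positive finite measure, so the quotient of [fine] values can be turned back into an
   inequality in the extended reals. *)
have /andP[b0 boo] := doubling_mball_gt0 x dbl r0.
have bfin : mu (mball rho x r) \is a fin_num by rewrite ge0_fin_numE // ltW.
have BF A : A `<=` mball rho x r -> mu A \is a fin_num.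
  move=> Ar; rewrite ge0_fin_numE ?outer_measure_ge0 //.
  by apply: le_lt_trans boo; exact: le_outer_measure.
apply: (@le_trans _ _ (mu (mball rho x r `\` B))).
  by apply: le_outer_measure; exact: setDS.
have f0 : 0 < fine (mu (mball rho x r)) by rewrite fine_gt0 // b0.
have afin : mu (mball rho x r `\` B) \is a fin_num by apply: BF; exact: subDsetl.
rewrite -(fineK afin) -(fineK bfin) -EFinM lee_fin -ler_pdivrMr //.
by apply: (le_trans (ler_norm _)); exact/ltW/h.
Qed.

Lemma density_ptI (R : realType) (X : Type) (rho : X -> X -> R)
    (mu : {outer_measure set X -> \bar R}) (B C : set X) x :
  density_pt rho mu B x -> density_pt rho mu C x -> density_pt rho mu (B `&` C) x.
Proof.
move=> dB dC e e0; have e2 : 0 < e / 2 by rewrite divr_gt0.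
have [s s0 hB] := dB _ e2; have [t t0 hC] := dC _ e2.
exists (Num.min s t); first by rewrite lt_min s0.
move=> r r0; rewrite lt_min => /andP[rs rt].
rewrite setDIr; apply: (le_trans (outer_measureU2 _ _ _)).
rewrite [e in leRHS]splitr EFinD ge0_muleDl ?lee_fin ?(ltW e2) //.
by apply: leeD; [exact: hB | exact: hC].
Qed.

(** This turns density into metric proximity, through which an approximate limit reaches every point
    near [x]. *)
Lemma density_pt_near (R : realType) (X : Type) (rho : X -> X -> R)
    (mu : {outer_measure set X -> \bar R}) (K e : R) (G : set X) x :
  doubling_mms rho mu K -> density_pt rho mu G x -> 0 < e -> e <= 1 ->
  exists2 delta : R, 0 < delta & forall z, z <> x -> rho x z < delta ->
    exists2 y, G y & rho z y < e * rho x z.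
Proof.
move=> dbl dG e0 e1; have [K0 [mm _] _ _ _] := dbl.
(* With [s] the distance from [x] to [z], radius [3 * s] suffices for a ball at [z] to contain the
   ball at [x] of radius [2 * s]; [m] doublings of [e * s] reach it. *)
have [m hm] : exists m, 3 <= 2 ^+ m * e.
  exists (Num.truncn (3 / e)).+1; rewrite -ler_pdivrMr //.
  apply: (le_trans (ltW (truncnS_gt _))); rewrite -natrX ler_nat ltnW //.
  exact: ltn_expl.
have Km0 : 0 < K ^+ m by exact: exprn_gt0.
(* The factor 1/2 makes the final contradiction strict. *)
have [delta d0 h] := dG ((K ^+ m)^-1 / 2) ltac:(by rewrite divr_gt0 // invr_gt0).
(* Otherwise [mball z (e * rho x z)] is a definite fraction of [mball x (2 * rho x z)]
   that misses [G]. *)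
exists (delta / 2); first by rewrite divr_gt0.
move=> z zx xzd; have s0 : 0 < rho x z by apply: metric_gt0 => // /esym.
set s := rho x z in xzd s0 *.
apply: contrapT => nG.
have es0 : 0 < e * s by rewrite mulr_gt0.
have es1 : e * s <= s by rewrite ler_piMl // ltW.
have hs : 3 * s <= 2 ^+ m * (e * s) by rewrite mulrA ler_pM2r.
have s20 : 0 < 2 * s by rewrite mulr_gt0.
have := h (2 * s) s20 ltac:(lra).
have /andP[b0 boo] := doubling_mball_gt0 x dbl s20.
have bfin : mu (mball rho x (2 * s)) \is a fin_num by rewrite ge0_fin_numE // ltW.
apply/negP; rewrite -ltNge.
have f0 : 0 < fine (mu (mball rho x (2 * s))) by rewrite fine_gt0 // b0.
rewrite -(@lte_pmul2l _ (K ^+ m)%:E) //.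
apply: (@lt_le_trans _ _ (mu (mball rho x (2 * s)))).
  rewrite -(fineK bfin) -!EFinM lte_fin.
  rewrite mulrA mulrA divff ?gt_eqF // mul1r; lra.
apply: (@le_trans _ _ (mu (mball rho z (2 ^+ m * (e * s))))).
  apply: le_outer_measure; apply: mball_setU => //.
  by rewrite mm.2.1 -/s; apply: le_trans hs; lra.
apply: (le_trans (doubling_mball_pow m z dbl es0)).
rewrite lee_pmul2l //; apply: le_outer_measure => y zy; split.
  by apply: (mball_setU mm _ zy); rewrite -/s; lra.
by move=> Gy; apply: nG; exists y.
Qed.

(** * Lipschitz extension to the closure *)

Definition m_closure (R : realType) (T : Type) (m : T -> T -> R) (E : set T) : set T :=
  [set x | forall r, 0 < r -> exists y, E y /\ m x y < r].

Lemma m_closed_closure (R : realType) (T : Type) (m : T -> T -> R) (E : set T) :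
  is_metric m -> m_closed m (m_closure m E).
Proof.
move=> [_ [_ tri]] x Ex r r0.
have r2 : 0 < r / 2 by rewrite divr_gt0.
have [y [/(_ _ r2)[z [Ez yz]] xy]] := Ex _ r2.
by exists z; split => //; have := tri x y z; lra.
Qed.

Lemma lipschitz_extend (R : realType) (X M : Type) (rho : X -> X -> R)
    (d : M -> M -> R) (E : set X) (f : X -> M) (k : R) :
  is_metric rho -> complete_metric d -> 0 < k ->
  (forall x y, E x -> E y -> d (f x) (f y) <= k * rho x y) ->
  exists g : X -> M, (forall x, E x -> g x = f x) /\
    forall x y, m_closure rho E x -> E y -> d (f y) (g x) <= k * rho y x.
Proof.
move=> mm [md cd] k0 Ef; have [_ [sym tri]] := mm; have [d0 [dsym dtri]] := md.
(* Values are chosen point by point. The estimate at [y = x] forces agreement with [f] on [E]; off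
   the closure the value is the default [f x]. *)
suff /choice[g gP] x : exists P, m_closure rho E x ->
    forall y, E y -> d (f y) P <= k * rho y x.
  exists g; split => [x Ex|x y Cx Ey]; last exact: gP.
  apply/esym/d0/eqP; rewrite eq_le metric_ge0 // andbT.
  rewrite (le_trans (gP x _ x Ex)) ?metric_xx ?mulr0 //.
  by move=> r r0; exists x; split => //; rewrite metric_xx.
have [Cx|] := pselect (m_closure rho E x); last by exists (f x).
have inv0 n : 0 < n.+1%:R^-1 :> R by rewrite invr_gt0.
have /choice[u uP] n := Cx _ (inv0 n).
have invle m n : (m <= n)%N -> n.+1%:R^-1 <= m.+1%:R^-1 :> R.
  by move=> mn; rewrite lef_pV2 ?posrE ?ler_nat.
(* Two terms within [e / (2 * k)] of [x] are less than [e / k] apart, so their images are less than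
   [e] apart. *)
have [e e0|P cP] := cd (f \o u).
  have [n _ ne] := near_infty_natSinv_lt (PosNum (divr_gt0 e0 (mulr_gt0 (ltr0n R 2) k0))).
  exists n => p q np nq /=.
  apply: (le_lt_trans (Ef _ _ (uP p).1 (uP q).1)).
  have up : rho x (u p) < n.+1%:R^-1 by apply: lt_le_trans (uP p).2 (invle _ _ np).
  have uq : rho x (u q) < n.+1%:R^-1 by apply: lt_le_trans (uP q).2 (invle _ _ nq).
  have := ne n (leqnn n); rewrite /= ltr_pdivlMr ?mulr_gt0 //.
  move: up uq; set i := n.+1%:R^-1 => up uq ne'.
  have : rho (u p) (u q) < 2 * i.
    by have := tri (u p) x (u q); rewrite (sym (u p) x); lra.
  rewrite -(ltr_pM2l k0); lra.
(* Half of [e] pays for replacing [P] by [f (u p)], the other half for replacing [x] by [u p]. *)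
exists P => _ y Ey; apply/ler_addgt0Pr => e e0.
have [N NP] := cP (e / 2) ltac:(by rewrite divr_gt0).
have [n _ ne] := near_infty_natSinv_lt (PosNum (divr_gt0 e0 (mulr_gt0 (ltr0n R 2) k0))).
set p := maxn N n.
have hp := NP p (leq_maxl _ _); have := ne p (leq_maxr _ _).
have := (uP p).2; rewrite /= in hp *; set i := p.+1%:R^-1 => up.
rewrite ltr_pdivlMr ?mulr_gt0 // => ne'.
have := dtri (f y) (f (u p)) P; have := Ef y (u p) Ey (uP p).1.
have : k * rho y (u p) <= k * (rho y x + i).
  by rewrite ler_pM2l //; have := tri y x (u p); lra.
by rewrite mulrDr; lra.
Qed.

(** * Upper limits and accumulation points *)

Lemma limsup_at_lty (R : realType) (X : Type) (rho : X -> X -> R) (A : set X) x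
    (g : X -> R) : (limsup_at rho A x g < +oo)%E ->
  exists c r, 0 < r /\ forall y, A y -> y <> x -> rho x y < r -> g y <= c.
Proof.
move=> /ereal_inf_lt[_ [r r0 <-]].
set S := [set _ | _ in _] => Soo.
(* The supremum is [-oo] if the punctured ball misses [A]; then [c = 0] serves. *)
have [c Sc] : exists c : R, (ereal_sup S <= c%:E)%E.
  by case: (ereal_sup S) Soo => [c| |] // _; [exists c | exists 0; rewrite leNye].
exists c, r; split => // y Ay yx xy; rewrite -lee_fin; apply: le_trans Sc.
by apply: ereal_sup_ubound; exists y.
Qed.

Lemma limsup_at_le (R : realType) (X : Type) (rho : X -> X -> R) (A : set X) x
    (g : X -> R) c : (forall y, A y -> y <> x -> g y <= c) ->
  (limsup_at rho A x g <= c%:E)%E.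
Proof.
move=> gc; apply: ge_ereal_inf; eexists; first by exists 1 => /=.
by apply: ge_ereal_sup => _ [y [[_ Ay] yx] <-]; rewrite lee_fin gc.
Qed.

Lemma mu_limsup_at_le (R : realType) (X : Type) (rho : X -> X -> R)
    (mu : {outer_measure set X -> \bar R}) (A : set X) x (g : X -> R) c :
  is_metric rho -> (forall y, A y -> y <> x -> g y <= c) ->
  (mu_limsup_at rho mu A x g <= c%:E)%E.
Proof.
move=> mm gc; apply: ge_ereal_inf; eexists.
  by exists (mball rho x 1) => //; exact: mball_nbhd.
by apply: ge_ereal_sup => _ [y [[_ Ay] yx] <-]; rewrite lee_fin gc.
Qed.

Lemma density_mu_acc_pt (R : realType) (X : Type) (rho : X -> X -> R)
    (mu : {outer_measure set X -> \bar R}) (K : R) (C : set X) x :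
  doubling_mms rho mu K -> density_pt rho mu C x -> acc_pt rho setT x ->
  mu_acc_pt rho mu C x.
Proof.
move=> dbl dC xX U /(mu_nbhd_density dbl) dU.
(* With [e = 1] the point found is strictly closer to [z] than [x] is, hence differs from [x]. *)
have [delta d0 h] := density_pt_near dbl (density_ptI dC dU) ltr01 (lexx _).
have [z [_ xz zx]] := xX _ d0; have [y [Cy Uy] zy] := h z zx xz.
exists y; split => // yx; move: zy; rewrite yx mul1r.
by have [_ [[_ [sym _]] _] _ _ _] := dbl; rewrite sym ltxx.
Qed.

(** This makes the set of non-isolated points measurable; at those points density yields
    [mu]-accumulation. *)
Lemma acc_pt_m_closed (R : realType) (X : Type) (rho : X -> X -> R) :
  is_metric rho -> m_closed rho (acc_pt rho setT).
Proof.
move=> mm x xacc r r0; have [_ [sym tri]] := mm.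
have r2 : 0 < r / 2 by rewrite divr_gt0.
have [y [yacc xy]] := xacc _ r2.
have [yx|yx] := pselect (y = x).
  by have [z [_ yz zy]] := yacc _ r0; exists z; rewrite -yx.
by exists y; split => //; lra.
Qed.

(** * Stepanov pieces *)

(** The distance from [f z] to [F z] is estimated through [g y] and [F y], for a point [y] of the
    closure much closer to [z] than [x] is, at which [g] is close to [F]. *)
Lemma approx_D_diff_upgrade (R : realType) (X M : Type) (rho : X -> X -> R)
    (d : M -> M -> R) (mu : {outer_measure set X -> \bar R}) (K k delta0 : R)
    (D : X -> M -> (X -> M) -> Prop) (A E : set X) (f g : X -> M) x :
  doubling_mms rho mu K -> is_metric d -> is_distribution rho d D ->
  0 < k -> 0 < delta0 -> E `<=` A ->
  (forall y z, E y -> A z -> rho y z < delta0 -> d (f z) (f y) <= k * rho z y) ->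
  (forall y, E y -> g y = f y) ->
  (forall y z, m_closure rho E y -> E z -> d (f z) (g y) <= k * rho z y) ->
  E x -> acc_pt rho A x -> density_pt rho mu (m_closure rho E) x ->
  approx_D_diff_at rho d mu D (m_closure rho E) g x ->
  D_diff_at rho d D A f x.
Proof.
move=> dbl md [Dgerm _] k0 delta00 EA Hf gE gC Ex Ax dx [_ _ [F [DF gF]]].
have [K0 [mm _] _ _ _] := dbl; have [_ [sym tri]] := mm; have [_ [dsym dtri]] := md.
split; [exact: EA | by [] | exists F; rewrite -gE //; split => // e e0].
have [Fx [r0 r00 [L FL]]] := Dgerm _ _ _ DF.
(* The summands are the constants of the three links [t1], [t2] and [t3] below; [h] is then chosen
   with [h * c < e]. *)
pose c := 3 * k + 2 + `|L|.
have L0 : 0 <= `|L| by exact: normr_ge0.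
have c0 : 0 < c by rewrite /c; lra.
pose h := Num.min 1 (e / (2 * c)).
have h0 : 0 < h by rewrite lt_min ltr01 divr_gt0 // mulr_gt0.
have h1 : h <= 1 by rewrite ge_min lexx.
have hc : h * c < e.
  have : h <= e / (2 * c) by rewrite ge_min lexx orbT.
  rewrite ler_pdivlMr ?mulr_gt0 //; lra.
have [U [Unb hU]] := gF h h0.
have [delta d0 near] :=
  density_pt_near dbl (density_ptI dx (mu_nbhd_density dbl Unb)) h0 h1.
(* The halves leave room for [y'] within [2 * s] of [z] and for [y] within [2 * s] of [x], where [s]
   is the distance from [z] to [x]. *)
exists (Num.min delta (Num.min (delta0 / 2) (r0 / 2))).
  by rewrite !lt_min d0 !divr_gt0.
move=> z Az zx; rewrite !lt_min => /and3P[zd zd0 zr].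
have s0 : 0 < rho z x by exact: metric_gt0.
rewrite ger0_norm; last by rewrite divr_ge0 ?metric_ge0.
rewrite ltr_pdivrMr //.
have [|y [Cy Uy] zy] := near z zx; first by rewrite sym.
rewrite (sym x z) in zy.
set s := rho z x in s0 zd zd0 zr zy *.
have hs0 : 0 < h * s by rewrite mulr_gt0.
have hs1 : h * s <= s by rewrite ler_piMl // ltW.
(* The one-sided estimate for [f] starts only from points of [E], so [y] is first replaced by a
   nearby [y'] in [E]. *)
have [y' [Ey' yy']] := Cy _ hs0.
have t1 : d (f z) (g y) <= 3 * k * (h * s).
  have zy' : rho y' z < 2 * (h * s).
    by have := tri y' y z; rewrite (sym y' y) (sym y z); lra.
  have := dtri (f z) (f y') (g y).
  have := gC y y' Cy Ey'; have := Hf y' z Ey' Az ltac:(lra).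
  have : k * rho z y' <= k * (2 * (h * s)) by rewrite ler_pM2l // sym ltW.
  have : k * rho y' y <= k * (h * s) by rewrite ler_pM2l // sym ltW.
  lra.
have yx2 : rho y x <= 2 * s.
  by have := tri y z x; rewrite -/s (sym y z); lra.
have t2 : d (g y) (F y) <= 2 * (h * s).
  (* The approximate limit says nothing at [x] itself, but there [F] and [g] agree. *)
  have [->|yx] := pselect (y = x).
    by rewrite Fx metric_xx // mulr_ge0 // ltW.
  have p0 : 0 < rho y x by exact: metric_gt0.
  have := hU y Uy Cy yx; rewrite ger0_norm; last by rewrite divr_ge0 ?metric_ge0.
  rewrite ltr_pdivrMr // => /ltW/le_trans; apply.
  have : h * rho y x <= h * (2 * s) by rewrite ler_pM2l.
  lra.
have t3 : d (F y) (F z) <= `|L| * (h * s).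
  have ry : mball rho x r0 y by rewrite /mball /= sym; lra.
  have rz : mball rho x r0 z by rewrite /mball /= sym -/s; lra.
  apply: (le_trans (FL _ _ ry rz)).
  apply: (@le_trans _ _ (`|L| * rho y z)).
    by rewrite ler_wpM2r ?metric_ge0 // ler_norm.
  by rewrite ler_wpM2l // sym ltW.
apply: (@le_lt_trans _ _ (c * (h * s))).
  have := dtri (f z) (g y) (F z); have := dtri (g y) (F y) (F z).
  rewrite /c !mulrDl; lra.
by rewrite mulrA ltr_pM2r // mulrC.
Qed.

(** Points of [E] are less than [delta0] apart, so the one-sided estimate applies to any two of them
    and [f] is Lipschitz on [E]. *)
Lemma stepanov_piece (R : realType) (X M : Type) (rho : X -> X -> R)
    (d : M -> M -> R) (mu : {outer_measure set X -> \bar R}) (K k delta0 : R)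
    (D : X -> M -> (X -> M) -> Prop) (A E : set X) (f : X -> M) :
  doubling_mms rho mu K -> complete_metric d -> is_distribution rho d D ->
  diff_complete rho d mu D -> 0 < k -> 0 < delta0 -> E `<=` A ->
  (forall y z, E y -> A z -> rho y z < delta0 -> d (f z) (f y) <= k * rho z y) ->
  (forall y z, E y -> E z -> rho y z < delta0) ->
  mu [set x | [/\ E x, acc_pt rho A x & ~ D_diff_at rho d D A f x]] = 0%E.
Proof.
move=> dbl cd Ddist dc k0 delta00 EA Hf Ediam.
have [K0 [mm _] _ _ _] := dbl; have [_ [sym tri]] := mm.
have [md _] := cd; have [_ [dsym dtri]] := md.
have [[x0 Ex0]|E0] := pselect (exists x, E x); last first.
  rewrite (_ : [set _ | _] = set0) ?outer_measure0 // -subset0 => x [Ex _ _].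
  by apply: E0; exists x.
have [|g [gE gC]] := @lipschitz_extend _ _ _ rho d E f k mm cd k0.
  by move=> y z Ey Ez; apply: Hf => //; [exact: EA | exact: Ediam].
set C := m_closure rho E in gC.
have clC : m_closed rho C by exact: m_closed_closure.
have EC x : E x -> C x by move=> Ex r r0; exists x; rewrite metric_xx.
(* A point [w] of [E] near [y] serves as intermediary; the detour costs at most [2 * k * rho y w],
   which is below [e]. *)
have gL y z : C y -> C z -> d (g y) (g z) <= k * rho y z.
  move=> Cy Cz; apply/ler_addgt0Pr => e e0.
  have [w [Ew yw]] := Cy _ (divr_gt0 e0 (mulr_gt0 (ltr0n R 2) k0)).
  move: yw; rewrite ltr_pdivlMr ?mulr_gt0 // => yw.
  have := dtri (g y) (f w) (g z); rewrite (dsym (g y) (f w)).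
  have := gC _ _ Cy Ew; have := gC _ _ Cz Ew; rewrite (sym w y).
  have : k * rho w z <= k * (rho y w + rho y z).
    by rewrite ler_pM2l // (sym y w); exact: tri.
  lra.
(* [P] is the set of density points of [C], written so that its measurability
   only uses that non-density points form a null set. *)
pose P := (C `\` (C `\` density_pt rho mu C)) `&` acc_pt rho setT.
have mclosed F : m_closed rho F -> mu.-caratheodory F.
  move=> clF; rewrite -(setCK F); apply: caratheodory_measurable_setC.
  by apply: (doubling_caratheodory_open dbl); exact: m_closedC.
have mP : mu.-caratheodory P.
  apply: caratheodory_measurable_setI.
    apply: caratheodory_measurable_setD; first exact: mclosed.
    by apply: caratheodory_null; exact: doubling_lebesgue_density dbl clC.
  by apply: mclosed; exact: acc_pt_m_closed.
have PC : P `<=` A_f_mu rho d mu C g.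
  move=> x [[Cx dx] xX]; split => //.
    apply: density_mu_acc_pt dbl _ xX.
    by apply: contrapT => ndx; apply: dx.
  apply: le_lt_trans (ltry k); apply: mu_limsup_at_le => // y Cy yx.
  by rewrite ler_pdivrMr ?metric_gt0 //; exact: gL.
have gdiff : mu [set x | P x /\ ~ approx_D_diff_at rho d mu D C g x] = 0%E.
  apply: (dc C g) => //; first by exists x0; exact: EC.
  by exists k.
apply: (@subset_outer_measure0 _ _ _ _ ((C `\` density_pt rho mu C) `|`
    [set x | P x /\ ~ approx_D_diff_at rho d mu D C g x])); last first.
  apply/eqP; rewrite eq_le outer_measure_ge0 andbT.
  apply: (le_trans (outer_measureU2 _ _ _)).
  by rewrite gdiff (doubling_lebesgue_density dbl clC) adde0.
move=> x [Ex Ax nfx].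
have [dx|ndx] := pselect (density_pt rho mu C x); last by left; split => //; exact: EC.
right; split.
  split; first by split; [exact: EC | case].
  by move=> r r0; have [y [_ xy yx]] := Ax r r0; exists y.
move=> gx; apply: nfx.
exact: (approx_D_diff_upgrade dbl md Ddist k0 delta00 EA Hf gE gC Ex Ax dx gx).
Qed.

(** * Almost nearest points of a closed set *)

Lemma near_projection (R : realType) (X : Type) (rho : X -> X -> R) (C : set X) :
  is_metric rho -> C !=set0 -> m_closed rho C ->
  exists p : X -> X, [/\ forall y, C (p y), forall y, C y -> p y = y &
    forall y z, C z -> rho (p y) y <= 2 * rho y z].
Proof.
move=> mm [c0 Cc0] clC; have [_ [sym _]] := mm.
suff /choice[p pP] y : exists c, [/\ C c, C y -> c = y &
    forall z, C z -> rho c y <= 2 * rho y z].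
  by exists p; split => [y|y|y]; case: (pP y).
have [Cy|nCy] := pselect (C y).
  exists y; split => // z _; rewrite metric_xx //.
  by apply: mulr_ge0 => //; exact: metric_ge0.
have [r r0 yr] := m_closedC clC nCy.
pose S := [set rho y c | c in C].
have rS : lbound S r.
  by move=> _ [c Cc <-]; rewrite leNgt; apply/negP => /yr; apply.
have S0 : S !=set0 by exists (rho y c0), c0.
have rinf : r <= inf S by apply: lb_le_inf.
have i0 : 0 < inf S by apply: lt_le_trans rinf.
(* The distance to [C] is positive since [C] is closed, so twice the infimum exceeds it and some
   point of [C] does better than that. *)
have [_ [c Cc <-] yc] : exists2 s, S s & s < inf S + inf S.
  by apply: inf_adherent => //; split => //; exists r.
exists c; split => // z Cz.
have : inf S <= rho y z by apply: ge_inf; [exists r | exists z].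
by rewrite (sym c); move: yc; set i := inf S; lra.
Qed.

(** * The two implications *)

Lemma diff_complete_ae_D_diff (R : realType) (X M : Type) (rho : X -> X -> R)
    (d : M -> M -> R) (mu : {outer_measure set X -> \bar R}) (K : R)
    (D : X -> M -> (X -> M) -> Prop) (A : set X) (f : X -> M) :
  doubling_mms rho mu K -> complete_metric d -> is_distribution rho d D ->
  diff_complete rho d mu D -> A !=set0 -> ae_D_diff rho d mu D A f.
Proof.
move=> dbl cd Ddist dc [x0 Ax0] B _ BA.
have [K0 [mm _] sep _ _] := dbl; have [_ [sym tri]] := mm.
have [md _] := cd; have [_ [dsym dtri]] := md.
have [s sdense] := separable_dense_seq x0 sep.
(* The index [n] governs both scale and slope; [k] confines the piece to a ball of half the scale,
   so its points are less than one scale apart. *)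
pose E n k := [set x | [/\ A x, rho (s k) x < n.+1%:R^-1 / 2 &
  forall y, A y -> rho x y < n.+1%:R^-1 -> d (f y) (f x) <= n.+1%:R * rho y x]].
apply: (@subset_outer_measure0 _ _ _ _ (\bigcup_n \bigcup_k
    [set x | [/\ E n k x, acc_pt rho A x & ~ D_diff_at rho d D A f x]])); last first.
  apply: outer_measure_bigcup0 => n; apply: outer_measure_bigcup0 => k.
  apply: (@stepanov_piece _ _ _ _ _ _ K n.+1%:R n.+1%:R^-1) => //.
  - by move=> x [].
  - by move=> y z [_ _]; exact.
  - move=> y z [_ sy _] [_ sz _]; have := tri y (s k) z; rewrite (sym y (s k)).
    by move: sy sz; set i := n.+1%:R^-1; lra.
move=> x [/BA[Ax accx fx] nfx]; have [c [r [r0 fr]]] := limsup_at_lty fx.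
have [n1 _ /(_ _ (leq_maxl _ (Num.truncn c))) /= n1r] := near_infty_natSinv_lt (PosNum r0).
(* [n1] brings the scale below [r], and [Num.truncn c] brings the slope above [c]. *)
set n := maxn n1 (Num.truncn c) in n1r.
have cn : c <= n.+1%:R.
  by apply: (le_trans (ltW (truncnS_gt c))); rewrite ler_nat ltnS leq_maxr.
have [k xk] := sdense x (n.+1%:R^-1 / 2) ltac:(by rewrite divr_gt0 // invr_gt0).
exists n => //; exists k => //; split => //; split => //; first by rewrite sym.
move=> y Ay xy; have [->|yx] := pselect (y = x).
  by rewrite !metric_xx // mulr0.
have yx0 : 0 < rho y x by exact: metric_gt0.
rewrite -ler_pdivrMr //; apply: le_trans cn; apply: fr => //.
exact: lt_trans xy n1r.
Qed.

Lemma ae_D_diff_diff_complete (R : realType) (X M : Type) (rho : X -> X -> R)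
    (d : M -> M -> R) (mu : {outer_measure set X -> \bar R})
    (D : X -> M -> (X -> M) -> Prop) :
  is_metric rho -> is_metric d ->
  (forall f : X -> M, ae_D_diff rho d mu D setT f) -> diff_complete rho d mu D.
Proof.
move=> mm md fdiff C g C0 clC [L gL] B mB BC; have [_ [sym tri]] := mm.
have [p [pC pid pnear]] := near_projection mm C0 clC.
have fE x : C x -> (g \o p) x = g x by move=> Cx /=; rewrite pid.
apply: subset_outer_measure0 (fdiff (g \o p) B mB _).
(* Metric balls are [mu]-neighborhoods, so a metric limit along [X] restricts to an approximate
   limit along [C], where [g \o p] equals [g]. *)
- move=> x [Bx ngx]; split => // -[_ _ [F [DF fF]]]; apply: ngx.
  have [Cx xacc _] := BC _ Bx; split => //.
  exists F; rewrite -fE //; split => // e e0; have [r r0 h] := fF e e0.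
  exists (mball rho x r); split; first exact: mball_nbhd.
  by move=> y xy Cy yx; rewrite -fE //; apply: h => //; rewrite sym.
- move=> x /BC[Cx xacc _]; split => //.
    move=> r r0; have [y [_ xy yx]] := xacc _ (mball_nbhd mu x mm r0).
    by exists y.
  (* For [x] in [C], [p y] is within [2 * rho y x] of [y], hence within [3 * rho y x] of [x]. The
     absolute value covers a negative [L]. *)
  apply: le_lt_trans (ltry (`|L| * 3)); apply: limsup_at_le => y _ yx.
  have yx0 : 0 < rho y x by exact: metric_gt0.
  rewrite ler_pdivrMr //= (pid x Cx).
  apply: (le_trans (gL _ _ (pC y) Cx)).
  apply: (@le_trans _ _ (`|L| * rho (p y) x)).
    by rewrite ler_wpM2r ?metric_ge0 // ler_norm.
  rewrite -mulrA ler_wpM2l //.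
  by have := tri (p y) y x; have := pnear y x Cx; lra.
Qed.

Theorem theorem2p9 (R : realType) (X M : Type) (rho : X -> X -> R)
  (d : M -> M -> R) (mu : {outer_measure set X -> \bar R}) (K : R)
  (D : X -> M -> (X -> M) -> Prop) :
  doubling_mms rho mu K -> complete_metric d -> is_distribution rho d D ->
  (diff_complete rho d mu D ->
     forall (A : set X) (f : X -> M), A !=set0 -> ae_D_diff rho d mu D A f) /\
  ((forall f : X -> M, ae_D_diff rho d mu D setT f) -> diff_complete rho d mu D).
Proof.
move=> dbl cd Ddist; split => [dc A f A0|].
  exact: diff_complete_ae_D_diff dbl cd Ddist dc A0.
by have [_ [mm _] _ _ _] := dbl; apply: ae_D_diff_diff_complete => //; case: cd.
Qed.
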